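(* Let $D$ be a nonempty, convex and closed subset of a real Hilbert space $H$, and let $f:D\to\mathbb{R}$ be a lower semicontinuous convex function which is smooth and whose gradient $f'$ satisfies the Lipschitz condition on $D$ with constant $L$. Suppose that the solution set $D^{*}(f)$ of the problem of minimizing $f$ over $D$ is nonempty. Apply Method (GPRM) (described in the context) with parameter sequences $\{\delta_l\}$, $\{\varepsilon_l\}$ satisfying $$\lim_{l\to\infty}\frac{\delta_l}{\varepsilon_l}=0.$$ Then: (i) for each number $l$ the number of iterations in $k$ is finite; (ii) the sequence $\{w^{l}\}$ converges strongly to the point $x^{*}_{n}$, the unique solution of the problem of minimizing $0.5\|x\|^{2}$ over $x\in D^{*}(f)$.
   Context: Notation. $\pi_D$ is the metric projection onto $D$. For $\varepsilon>0$ set $\varphi_{\varepsilon}(x)=f(x)+0.5\varepsilon\|x\|^{2}$, with gradient $\varphi_{\varepsilon}'(x)=f'(x)+\varepsilon x$. $\{a_l\}\searrow 0$ means that $\{a_l\}$ is a decreasing sequence of positive numbers converging to $0$. $\mathbb{Z}_{+}$ is the set of non-negative integers. $D^{*}(f)$ is the set of minimizers of $f$ over $D$. Method (GPRM). Step 0: Choose a point $w^{0}\in D$, numbers $\beta\in(0,1)$, $\theta\in(0,1)$, sequences $\{\delta_l\}\searrow 0$ and $\{\varepsilon_l\}\searrow 0$ (indexed by $l=0,1,\ldots$). Set $l=1$. Step 1: Set $x^{0}=w^{l-1}$, $k=0$. Step 2: Take $y^{k}=\pi_D[x^{k}-\varphi_{\varepsilon_l}'(x^{k})]$. If $\|x^{k}-y^{k}\|\le\delta_l$,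 let $w^{l}$ be whichever of the two points $x^{k},y^{k}$ has the smaller value of $\varphi_{\varepsilon_l}$, set $l=l+1$ and go to Step 1. Step 3: Set $d^{k}=y^{k}-x^{k}$, determine $m$ as the smallest number in $\mathbb{Z}_{+}$ such that $$\varphi_{\varepsilon_l}(x^{k}+\theta^{m}d^{k})\le\varphi_{\varepsilon_l}(x^{k})-\beta\theta^{m}\|d^{k}\|^{2},$$ set $\lambda_k=\theta^{m}$, $x^{k+1}=x^{k}+\lambda_k d^{k}$, $k=k+1$, and go to Step 2. (The points $x^k,y^k$ depend also on the current $l$; this dependence is suppressed.) *)

(* Defs.v *)
From HB Require Import structures.
From mathcomp Require Import all_boot all_order all_algebra.
From mathcomp Require Import all_classical all_reals all_analysis.
From mathcomp Require Import sesquilinear.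

Set Implicit Arguments.
Unset Strict Implicit.
Unset Printing Implicit Defensive.

Import Order.TTheory GRing.Theory Num.Theory.
Import numFieldNormedType.Exports.

Local Open Scope classical_set_scope.
Local Open Scope ring_scope.

(* A real Hilbert space is a complete normed module H over a realType R,
   together with an inner product ip : {dot H for idfun} such that
   ip x x = `|x| ^+ 2.  A function on a subset D of H is represented by a total
   function on H of which only the values on D are ever used. *)

Definition minimizers (R : realType) (H : Type) (D : set H) (g : H -> R) :
  set H := [set x | D x /\ forall z, D z -> g x <= g z].

(* The default value 0 is irrelevant when D is nonempty, closed and convex in a
   Hilbert space, since there is then exactly one nearest point. *)
Definition metric_proj (R : realType) (H : completeNormedModType R)
  (D : set H) (x : H) : H := xget 0 (minimizers D (fun z => `|x - z|)).

(* Frechet differentiability relative to D: no neighbourhood of D is assumed to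
   lie in the domain of f.  If f is differentiable on a neighbourhood of D, its
   usual gradient has this property; when D has empty interior other vectors may
   have it too. *)
Definition is_gradient_on (R : realType) (H : completeNormedModType R)
    (ip : {dot H for idfun}) (D : set H) (f : H -> R) (f' : H -> H) : Prop :=
  forall x, D x ->
    (fun y => f y - f x - ip (f' x) (y - x) : R^o)
      =o_ (within D (nbhs x)) (fun y => y - x).

Definition regularized (R : realType) (H : completeNormedModType R)
  (f : H -> R) (eps : R) (x : H) : R := f x + 2^-1 * eps * `|x| ^+ 2.

Definition regularized_gradient (R : realType) (H : completeNormedModType R)
  (f' : H -> H) (eps : R) (x : H) : H := f' x + eps *: x.

Definition armijo (R : realType) (H : completeNormedModType R)
    (phi : H -> R) (beta theta : R) (x d : H) (m : nat) : Prop :=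
  phi (x + theta ^+ m *: d) <= phi x - beta * theta ^+ m * `|d| ^+ 2.

Definition armijo_exponent (R : realType) (H : completeNormedModType R)
    (phi : H -> R) (beta theta : R) (x d : H) (m : nat) : Prop :=
  armijo phi beta theta x d m /\
  forall m', armijo phi beta theta x d m' -> (m <= m')%N.

Definition gprm_y (R : realType) (H : completeNormedModType R) (D : set H)
    (f' : H -> H) (eps : nat -> R) (x : nat -> nat -> H) (l k : nat) : H :=
  metric_proj D (x l k - regularized_gradient f' (eps l) (x l k)).

Definition gprm_stop (R : realType) (H : completeNormedModType R) (D : set H)
    (f' : H -> H) (delta eps : nat -> R) (x : nat -> nat -> H) (l k : nat)
    : Prop :=
  `|x l k - gprm_y D f' eps x l k| <= delta l.

Definition gprm_first_stop (R : realType) (H : completeNormedModType R)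
    (D : set H) (f' : H -> H) (delta eps : nat -> R) (x : nat -> nat -> H)
    (l k : nat) : Prop :=
  gprm_stop D f' delta eps x l k /\
  forall j, (j < k)%N -> ~ gprm_stop D f' delta eps x l j.

Definition gprm_exponent (R : realType) (H : completeNormedModType R)
    (D : set H) (f : H -> R) (f' : H -> H) (beta theta : R) (eps : nat -> R)
    (x : nat -> nat -> H) (l k m : nat) : Prop :=
  armijo_exponent (regularized f (eps l)) beta theta
    (x l k) (gprm_y D f' eps x l k - x l k) m.

(* w and x l k are produced by the method started at w 0; the outer counter
   l >= 1 is written l.+1.  The last two clauses are conditional: they
   constrain x l.+1 k.+1 only if iteration k of stage l.+1 is reached without
   stopping and its line search succeeds, and w l.+1 only if stage l.+1 stops.
   Entries that the method never computes are arbitrary, so that termination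
   is not presupposed.  On a tie in the choice of w l.+1 both points are
   allowed. *)
Record gprm_run (R : realType) (H : completeNormedModType R)
    (D : set H) (f : H -> R) (f' : H -> H) (beta theta : R)
    (delta eps : nat -> R) (w : nat -> H) (x : nat -> nat -> H) : Prop := {
  gprm_start : D (w 0%N);
  gprm_stage : forall l, x l.+1 0%N = w l;
  gprm_next : forall l k m,
    (forall j, (j <= k)%N -> ~ gprm_stop D f' delta eps x l.+1 j) ->
    gprm_exponent D f f' beta theta eps x l.+1 k m ->
    x l.+1 k.+1 =
      x l.+1 k + theta ^+ m *: (gprm_y D f' eps x l.+1 k - x l.+1 k);
  gprm_output : forall l k,
    gprm_first_stop D f' delta eps x l.+1 k ->
    minimizers [set x l.+1 k; gprm_y D f' eps x l.+1 k]
      (regularized f (eps l.+1)) (w l.+1)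
}.

(* Main.v *)
(* The step length found by the line search is bounded below, since phi_eps is
   convex with a Lipschitz gradient; so every iteration of a stage that does not
   stop decreases phi_eps by a fixed amount, and phi_eps is bounded below.

   If |u - y| <= delta with y the projected gradient step from u, strong
   convexity gives, for the minimal-norm solution q and some constant k,
     |y|^2 + |y - q|^2 <= |q|^2 + 2 k (delta / eps) |y - q|.
   Hence limsup |y| <= |q| and f(y) tends to the minimum.  Weak compactness is
   avoided by producing q as the limit of almost minimal-norm points of the
   sublevel sets {f <= min f + 1/n}: by the parallelogram law this sequence is
   Cauchy and |q| is the limit of the distances from 0 to these sets, so that a
   second use of the parallelogram law turns the two facts on y into strong
   convergence.  Metric projections come from the same nested-set lemma. *)

Require Import Defs.
From HB Require Import structures.
From mathcomp Require Import all_boot all_order all_algebra.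
From mathcomp Require Import all_classical all_reals all_analysis.
From mathcomp Require Import sesquilinear.
From mathcomp Require Import ring lra.

Set Implicit Arguments.
Unset Strict Implicit.
Unset Printing Implicit Defensive.

Import Order.TTheory GRing.Theory Num.Theory.
Import numFieldNormedType.Exports.

Local Open Scope classical_set_scope.
Local Open Scope ring_scope.

(** * Inner products, and convexity along segments *)

Lemma dotC (R : realType) (H : lmodType R) (ip : {dot H for idfun}) (u v : H) :
  ip u v = ip v u.
Proof. by rewrite [LHS](@hermC _ _ idfun) /= expr0 mul1r. Qed.

Lemma dotZr (R : realType) (H : lmodType R) (ip : {dot H for idfun})
    (a : R) (u v : H) : ip u (a *: v) = a * ip u v.
Proof. by rewrite linearZr_LR. Qed.

Lemma dotZl (R : realType) (H : lmodType R) (ip : {dot H for idfun})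
    (a : R) (u v : H) : ip (a *: u) v = a * ip u v.
Proof. by rewrite dotC dotZr dotC. Qed.

Lemma sqr_normD (R : realType) (H : completeNormedModType R)
    (ip : {dot H for idfun}) (ip_norm : forall x : H, ip x x = `|x| ^+ 2)
    (u v : H) : `|u + v| ^+ 2 = `|u| ^+ 2 + 2 * ip u v + `|v| ^+ 2.
Proof.
rewrite -!ip_norm linearDl !linearDr /= (dotC ip v u); ring.
Qed.

Lemma sqr_normB (R : realType) (H : completeNormedModType R)
    (ip : {dot H for idfun}) (ip_norm : forall x : H, ip x x = `|x| ^+ 2)
    (u v : H) : `|u - v| ^+ 2 = `|u| ^+ 2 - 2 * ip u v + `|v| ^+ 2.
Proof. by rewrite (sqr_normD ip_norm) normrN linearNr mulrN. Qed.

(** The parallelogram law, with the midpoint written as a point of the segment, the form in which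
    convexity supplies it. *)
Lemma sqr_norm_midpoint (R : realType) (H : completeNormedModType R)
    (ip : {dot H for idfun}) (ip_norm : forall x : H, ip x x = `|x| ^+ 2)
    (u v : H) :
  `|u - v| ^+ 2 = 2 * `|u| ^+ 2 + 2 * `|v| ^+ 2
                  - 4 * `|u + 2^-1 *: (v - u)| ^+ 2.
Proof.
have -> : u + 2^-1 *: (v - u) = 2^-1 *: (u + v).
  rewrite scalerBr addrCA addrC scalerDr; congr (_ + _).
  by rewrite -[X in X - _]scale1r -scalerBl; congr (_ *: _); field.
rewrite normrZ exprMn (sqr_normB ip_norm) (sqr_normD ip_norm) ger0_norm //.
by field.
Qed.

Lemma dot_le_norm (R : realType) (H : completeNormedModType R)
    (ip : {dot H for idfun}) (ip_norm : forall x : H, ip x x = `|x| ^+ 2)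
    (u v : H) : ip u v <= `|u| * `|v|.
Proof.
have [->|u0] := eqVneq u 0; first by rewrite linear0l normr0 mul0r.
have [->|v0] := eqVneq v 0; first by rewrite linear0r normr0 mulr0.
have uv0 : 0 < `|u| * `|v| by rewrite mulr_gt0 ?normr_gt0.
have := sqr_ge0 `| `|v| *: u - `|u| *: v|.
rewrite (sqr_normB ip_norm) !normrZ !normr_id dotZl dotZr => h.
have {}h : 0 <= 2 * (`|u| * `|v|) * (`|u| * `|v| - ip u v) by lra.
by move: h; rewrite pmulr_rge0 ?subr_ge0 // mulr_gt0.
Qed.

Lemma convex_set_segment (R : realType) (H : lmodType R) (D : set H)
    (D_convex : convex_set D) (u v : H) (t : R) :
  D u -> D v -> 0 <= t <= 1 -> D (u + t *: (v - u)).
Proof.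
move=> Du Dv /andP[t0 t1].
have := D_convex v u (Itv01 t0 t1) (mem_set Dv) (mem_set Du).
rewrite inE; congr D; rewrite /conv /=.
by rewrite scalerBr scalerBl scale1r addrCA.
Qed.

Lemma convex_function_segment (R : realType) (H : lmodType R) (D : set H)
    (f : H -> R) (f_convex : convex_function D f) (u v : H) (t : R) :
  D u -> D v -> 0 <= t <= 1 ->
  f (u + t *: (v - u)) <= f u + t * (f v - f u).
Proof.
move=> Du Dv /andP[t0 t1].
have := f_convex (Itv01 t0 t1) v u (mem_set Dv) (mem_set Du).
rewrite convRE /conv /=.
have -> : t *: v + (1 - t) *: u = u + t *: (v - u).
  by rewrite scalerBr scalerBl scale1r addrCA.
by move/le_trans; apply; rewrite /unstable.onem; lra.
Qed.

(** A substitute for letting [t] tend to 0 in first-order inequalities. *)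
Lemma le0_of_le_mulr (R : realType) (a b : R) :
  (forall t, 0 < t <= 1 -> a <= t * b) -> a <= 0.
Proof.
move=> h; rewrite leNgt; apply/negP => a0.
have ab : a <= b by have := h 1; rewrite mul1r; apply; rewrite ltr01 lexx.
have b0 : 0 < b by exact: lt_le_trans ab.
have := h (a / (2 * b)).
rewrite divr_gt0 ?mulr_gt0 //= ler_pdivrMr ?mulr_gt0 // mul1r => /(_ _)/wrap[].
  lra.
suff -> : a / (2 * b) * b = a / 2 by lra.
by field; rewrite gt_eqF.
Qed.

(** * Nested closed sets and metric projections *)

(** The infima of the squared norm over [C n] increase to a limit [M], finite because [p] lies in
    every [C n]. Almost minimal points are Cauchy by the parallelogram law, and closedness keeps
    their limit in every [C n]. *)
Lemma nested_min_norm (R : realType) (H : completeNormedModType R)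
    (ip : {dot H for idfun}) (ip_norm : forall x : H, ip x x = `|x| ^+ 2)
    (C : nat -> set H) (p : H) :
  (forall n, C n p) -> (forall n, closed (C n)) ->
  (forall n u v, C n u -> C n v -> C n (u + 2^-1 *: (v - u))) ->
  (forall m n, (m <= n)%N -> C n `<=` C m) ->
  exists2 q, (forall n, C n q) &
    forall e : R, 0 < e ->
      exists n, forall z, C n z -> `|q| ^+ 2 - e <= `|z| ^+ 2.
Proof.
move=> Cp Ccl Cmid Cle.
(* [S] collects the lower bounds valid on some [C n], so its supremum is the limit of the infima. *)
pose S : set R := [set a | exists n, forall z, C n z -> a <= `|z| ^+ 2].
have S0 : S 0 by exists 0%N => z _; exact: sqr_ge0.
have Ssup : has_sup S.
  split; first by exists 0.
  by exists (`|p| ^+ 2) => a [n]; apply.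
pose M := sup S.
have M_low (e : R) : 0 < e -> exists n, forall z, C n z -> M - e < `|z| ^+ 2.
  move=> e0; have [a [n Ca] Ma] := sup_adherent e0 Ssup.
  by exists n => z Cz; exact: lt_le_trans Ma (Ca z Cz).
have M_up n (e : R) : 0 < e -> exists2 z, C n z & `|z| ^+ 2 < M + e.
  move=> e0; apply: contrapT => h.
  suff : M + e <= M by rewrite leNgt ltrDl e0.
  apply: (ub_le_sup Ssup.2); exists n => z Cz.
  by rewrite leNgt; apply/negP => ?; apply: h; exists z.
clearbody M => {S S0 Ssup}.
have /choice[q qP] : forall n, exists z, C n z /\ `|z| ^+ 2 < M + n.+1%:R^-1.
  move=> n.
  by have [|z ? ?] := M_up n n.+1%:R^-1; [rewrite invr_gt0 | exists z].
have inv_le (e : R) : 0 < e ->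
    exists N, forall n, (N <= n)%N -> n.+1%:R^-1 < e :> R.
  by move=> e0; have [N _ hN] := near_infty_natSinv_lt (PosNum e0); exists N.
have q_cauchy (e : R) : 0 < e ->
    exists N, forall n, (N <= n)%N -> `|q N - q n| < e.
  (* The two squared norms count twice and the midpoint four times, each with error at most [e']:
     the total stays below [8 * e']. *)
  move=> e0; have [e' e'0 ee'] : exists2 e', 0 < e' & e ^+ 2 = 9 * e'.
    exists (e ^+ 2 / 9); first by rewrite divr_gt0 ?exprn_gt0.
    by field.
  have [N1 hN1] := M_low _ e'0; have [N2 hN2] := inv_le _ e'0.
  pose N := maxn N1 N2.
  exists N => n Nn.
  have Cn : C N1 (q n).
    by apply: (Cle _ n); [exact: leq_trans (leq_maxl _ _) Nn | exact: (qP n).1].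
  have CN : C N1 (q N).
    by apply: (Cle _ N); [exact: leq_maxl | exact: (qP N).1].
  suff dist2 : `|q N - q n| ^+ 2 < e ^+ 2.
    by rewrite ltr_pXn2r ?nnegrE ?(ltW e0) // in dist2.
  have := hN1 _ (Cmid _ _ _ CN Cn).
  have := (qP n).2; have := (qP N).2.
  have := hN2 _ (leq_maxr N1 N2); have := hN2 _ (leq_trans (leq_maxr _ _) Nn).
  have := sqr_norm_midpoint ip_norm (q N) (q n).
  by rewrite -/N ee'; move: (N.+1%:R^-1) (n.+1%:R^-1) => a b; lra.
have : cvg (q @ \oo).
  apply/cauchy_cvgP/cauchyP => e /q_cauchy[N hN].
  by exists (q N); exists N => // n Nn; rewrite -ball_normE; exact: hN.
move=> /cvg_ex[l ql]; exists l => [n|e e0].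
  apply: (closed_cvg (C n) (Ccl n) _ l ql); exists n => // m /= nm.
  by apply: Cle nm _ _; exact: (qP m).1.
have lM : `|l| ^+ 2 <= M + e / 2.
  have [N hN] := inv_le _ (divr_gt0 e0 (ltr0n _ 2)).
  have cn : `|q n| ^+ 2 @[n --> \oo] --> `|l| ^+ 2.
    by rewrite expr2; apply: cvgM; exact: cvg_norm.
  apply: (cvgr_to_le cn).
  exists N => // n /= Nn; have := hN _ Nn; have := (qP n).2.
  by move: (n.+1%:R^-1) => a; lra.
have [n hn] := M_low _ (divr_gt0 e0 (ltr0n _ 2)).
by exists n => z Cz; have := hn _ Cz; lra.
Qed.

(** Projecting [v] means finding the point of least norm in [D] translated by [- v], a constant
    sequence of sets. *)
Lemma metric_projP (R : realType) (H : completeNormedModType R)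
    (ip : {dot H for idfun}) (ip_norm : forall x : H, ip x x = `|x| ^+ 2)
    (D : set H) (D_nonempty : D !=set0) (D_convex : convex_set D)
    (D_closed : closed D) (v : H) :
  minimizers D (fun z => `|v - z|) (metric_proj D v).
Proof.
case: D_nonempty => p Dp; apply: xgetPex.
have [||u z1 z2 D1 D2||q Dq qmin] :=
    @nested_min_norm _ _ _ ip_norm (fun=> [set z | D (z + v)]) (p - v).
- by move=> _ /=; rewrite subrK.
- move=> _; apply: (closed_comp (f := fun z => z + v)) D_closed => z _.
  by apply: cvgD; [exact: cvg_id | exact: cvg_cst].
- move=> /=; have -> : z1 + 2^-1 *: (z2 - z1) + v =
      (z1 + v) + 2^-1 *: ((z2 + v) - (z1 + v)).
    by rewrite opprD addrACA subrr addr0 addrAC.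
  by apply: convex_set_segment => //; lra.
- by move=> ? ? _.
exists (q + v); split=> [|z Dz]; first exact: Dq 0%N.
rewrite opprD addrCA subrr addr0 normrN distrC.
rewrite -(@ler_pXn2r _ 2%N) ?nnegrE //; apply/ler_addgt0Pr => e e0.
have [_ he] := qmin e e0.
by rewrite -lerBlDr; apply: he => /=; rewrite subrK.
Qed.

(** Moving from the projection towards [z] stays in [D] and cannot shorten the distance to [v]; the
    quadratic term vanishes with [t]. *)
Lemma metric_proj_dot_le0 (R : realType) (H : completeNormedModType R)
    (ip : {dot H for idfun}) (ip_norm : forall x : H, ip x x = `|x| ^+ 2)
    (D : set H) (D_convex : convex_set D) (D_closed : closed D) (v z : H) :
  D z -> ip (v - metric_proj D v) (z - metric_proj D v) <= 0.
Proof.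
move=> Dz; have D0 : D !=set0 by exists z.
have [] := metric_projP ip_norm D0 D_convex D_closed v.
move: (metric_proj D v) => p Dp pmin.
suff : 2 * ip (v - p) (z - p) <= 0 by rewrite pmulr_rle0.
apply: (@le0_of_le_mulr _ _ (`|z - p| ^+ 2)) => t /andP[t0 t1].
have Dt : D (p + t *: (z - p)) by apply: convex_set_segment; rewrite ?t1 ?ltW.
have := pmin _ Dt; rewrite -(@ler_pXn2r _ 2%N) ?nnegrE //.
rewrite opprD addrA [leRHS](sqr_normB ip_norm) dotZr normrZ (gtr0_norm t0) => h.
by rewrite -(ler_pM2l t0); move: h; move: (ip _ _) => a; lra.
Qed.

(** * First-order inequalities on [D] *)

(** On a short segment from [u] towards [v], convexity bounds the increment of [f] from above and
    differentiability from below, up to a factor [e] times the length; divide by [t] and let [e]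
    vanish. *)
Lemma gradient_le (R : realType) (H : completeNormedModType R)
    (ip : {dot H for idfun}) (D : set H) (D_convex : convex_set D)
    (f : H -> R) (f_convex : convex_function D f)
    (f' : H -> H) (f_gradient : is_gradient_on ip D f f') (u v : H) :
  D u -> D v -> f u + ip (f' u) (v - u) <= f v.
Proof.
move=> Du Dv; rewrite -subr_le0.
apply: (@le0_of_le_mulr _ _ `|v - u|) => e /andP[e0 _].
have /eqoP/(_ e e0) := f_gradient u Du.
rewrite /within /= => /nbhs_ballP[r /= r0 hr].
(* Small enough to stay in the ball of radius [r]; the added 1 avoids a zero denominator when
   [u = v]. *)
pose t := Num.min 1 (r / (2 * (`|v - u| + 1))).
have c0 : 0 < 2 * (`|v - u| + 1) by have := normr_ge0 (v - u); lra.
have t0 : 0 < t by rewrite lt_min ltr01 divr_gt0.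
have t1 : t <= 1 by rewrite ge_min lexx.
have tr : t * `|v - u| < r.
  have : t <= r / (2 * (`|v - u| + 1)) by rewrite ge_min lexx orbT.
  rewrite ler_pdivlMr // => h; have := normr_ge0 (v - u).
  have : 0 <= t * `|v - u| by rewrite mulr_ge0 // ltW.
  lra.
have t01 : 0 <= t <= 1 by rewrite t1 ltW.
have /hr/(_ (convex_set_segment D_convex Du Dv t01)) :
    ball u r (u + t *: (v - u)).
  by rewrite -ball_normE /= opprD addNKr normrN normrZ gtr0_norm.
have := convex_function_segment f_convex Du Dv t01.
rewrite [_ + _ - u]addrAC subrr add0r dotZr normrZ (gtr0_norm t0) => h1.
rewrite ler_norml => /andP[h2 _].
rewrite -(ler_pM2l t0); move: h1 h2; move: (ip _ _) (f _) => a b; lra.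
Qed.

Lemma regularized_ge (R : realType) (H : completeNormedModType R)
    (ip : {dot H for idfun}) (ip_norm : forall x : H, ip x x = `|x| ^+ 2)
    (D : set H) (D_convex : convex_set D)
    (f : H -> R) (f_convex : convex_function D f)
    (f' : H -> H) (f_gradient : is_gradient_on ip D f f')
    (e : R) (u v : H) :
  D u -> D v ->
  regularized f e u + ip (regularized_gradient f' e u) (v - u)
    + 2^-1 * e * `|v - u| ^+ 2 <= regularized f e v.
Proof.
move=> Du Dv; have := gradient_le D_convex f_convex f_gradient Du Dv.
rewrite /regularized /regularized_gradient linearDl /= dotZl.
have /= := sqr_normD ip_norm u (v - u); rewrite subrKC => ->.
move: (ip _ _) (ip _ _) => a b; lra.
Qed.

Lemma lipschitz_dot_le (R : realType) (H : completeNormedModType R)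
    (ip : {dot H for idfun}) (ip_norm : forall x : H, ip x x = `|x| ^+ 2)
    (D : set H) (g : H -> H) (L : R) (g_lipschitz : L.-lipschitz_D g)
    (u v h : H) :
  D u -> D v -> ip (g v - g u) h <= `|L| * `|v - u| * `|h|.
Proof.
move=> Du Dv; apply: le_trans (dot_le_norm ip_norm _ _) _.
apply: ler_wpM2r => //; apply: le_trans (g_lipschitz (v, u) (conj Dv Du)) _.
by rewrite /= ler_wpM2r // ler_norm.
Qed.

(* The constant is |L| rather than L / 2 because the bound comes from the
   gradient inequality at v instead of an integral along the segment. *)
Lemma regularized_le (R : realType) (H : completeNormedModType R)
    (ip : {dot H for idfun}) (ip_norm : forall x : H, ip x x = `|x| ^+ 2)
    (D : set H) (D_convex : convex_set D)
    (f : H -> R) (f_convex : convex_function D f)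
    (f' : H -> H) (f_gradient : is_gradient_on ip D f f')
    (L : R) (f'_lipschitz : L.-lipschitz_D f')
    (e : R) (e_gt0 : 0 < e) (u v : H) :
  D u -> D v ->
  regularized f e v <= regularized f e u
    + ip (regularized_gradient f' e u) (v - u) + (`|L| + e) * `|v - u| ^+ 2.
Proof.
move=> Du Dv; have := gradient_le D_convex f_convex f_gradient Dv Du.
have := lipschitz_dot_le ip_norm f'_lipschitz (v - u) Du Dv.
rewrite linearBl /= -[u - v]opprB linearNr /regularized /regularized_gradient.
rewrite linearDl /= dotZl.
have /= := sqr_normD ip_norm u (v - u); rewrite subrKC => ->.
have : 0 <= e * `|v - u| ^+ 2 by rewrite mulr_ge0 // ltW.
by rewrite expr2; move: (ip _ _) (ip _ _) (ip _ _) => a b c; lra.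
Qed.

(** * The Armijo line search *)

(** The projection inequality tested at [u] itself gives slope at most minus the squared length of
    the direction; for a small step the quadratic error costs at most the fraction [1 - beta] of
    this decrease. *)
Lemma armijo_small_step (R : realType) (H : completeNormedModType R)
    (ip : {dot H for idfun}) (ip_norm : forall x : H, ip x x = `|x| ^+ 2)
    (D : set H) (D_convex : convex_set D) (D_closed : closed D)
    (f : H -> R) (f_convex : convex_function D f)
    (f' : H -> H) (f_gradient : is_gradient_on ip D f f')
    (L : R) (f'_lipschitz : L.-lipschitz_D f')
    (e : R) (e_gt0 : 0 < e) (beta theta : R) (theta01 : 0 < theta < 1)
    (u : H) (m : nat) :
  D u -> (`|L| + e) * theta ^+ m <= 1 - beta ->
  armijo (regularized f e) beta theta u
    (metric_proj D (u - regularized_gradient f' e u) - u) m.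
Proof.
move=> Du; set g := regularized_gradient f' e u.
have D0 : D !=set0 by exists u.
have [Dy _] := metric_projP ip_norm D0 D_convex D_closed (u - g).
have := metric_proj_dot_le0 ip_norm D_convex D_closed (u - g) Du.
move: (metric_proj _ _) Dy => y Dy vi ht; rewrite /armijo.
have t0 : 0 < theta ^+ m by rewrite exprn_gt0 //; case/andP: theta01.
have t1 : theta ^+ m <= 1.
  by rewrite exprn_ile1 //; case/andP: theta01 => *; lra.
move: (theta ^+ m) t0 t1 ht => t t0 t1 ht.
have Dt : D (u + t *: (y - u)) by apply: convex_set_segment; rewrite ?t1 ?ltW.
have gd : ip g (y - u) <= - `|y - u| ^+ 2.
  move: vi; rewrite addrAC -[u - y]opprB linearNr /= linearBl linearNl /=.
  by rewrite ip_norm; move: (ip _ _) => a; lra.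
have := regularized_le ip_norm D_convex f_convex f_gradient f'_lipschitz
  e_gt0 Du Dt.
rewrite -/g [_ + _ - u]addrAC subrr add0r dotZr normrZ (gtr0_norm t0).
move=> /le_trans; apply.
rewrite -addrA lerD2l.
have : t * ip g (y - u) <= t * - `|y - u| ^+ 2 by rewrite ler_pM2l.
have : (`|L| + e) * t * (t * `|y - u| ^+ 2) <= (1 - beta) * (t * `|y - u| ^+ 2).
  by rewrite ler_wpM2r // mulr_ge0 // ltW.
move: (ip _ _) => a; lra.
Qed.

(** A least exponent is either 0, with step 1, or its predecessor violates the smallness condition
    of the preceding lemma, which bounds the step from below. *)
Lemma armijo_exponent_lower_bound (R : realType) (H : completeNormedModType R)
    (ip : {dot H for idfun}) (ip_norm : forall x : H, ip x x = `|x| ^+ 2)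
    (D : set H) (D_convex : convex_set D) (D_closed : closed D)
    (f : H -> R) (f_convex : convex_function D f)
    (f' : H -> H) (f_gradient : is_gradient_on ip D f f')
    (L : R) (f'_lipschitz : L.-lipschitz_D f')
    (e : R) (e_gt0 : 0 < e)
    (beta theta : R) (beta01 : 0 < beta < 1) (theta01 : 0 < theta < 1) :
  exists2 c, 0 < c & forall u, D u -> exists2 m,
    armijo_exponent (regularized f e) beta theta u
      (metric_proj D (u - regularized_gradient f' e u) - u) m &
    c <= theta ^+ m.
Proof.
have /andP[th0 th1] := theta01.
have b0 : 0 < 1 - beta by case/andP: beta01; lra.
have K0 : 0 < `|L| + e by have := normr_ge0 L; lra.
exists (Num.min 1 (theta * (1 - beta) / (`|L| + e))).
  by rewrite lt_min ltr01 divr_gt0 ?mulr_gt0.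
move=> u Du.
have small := armijo_small_step ip_norm D_convex D_closed f_convex f_gradient
  f'_lipschitz e_gt0 theta01 Du.
move: (metric_proj _ _ - u) small => d small.
(* Unfolded to a boolean inequality, so that a least exponent can be extracted. *)
have ex : exists m, regularized f e (u + theta ^+ m *: d)
    <= regularized f e u - beta * theta ^+ m * `|d| ^+ 2.
  have th : (fun n => theta ^+ n) @ \oo --> (0 : R).
    by apply: cvg_expr; rewrite gtr0_norm.
  have pos : 0 < (1 - beta) / (`|L| + e) by rewrite divr_gt0.
  have [m _ /(_ m (leqnn m)) hm] := cvgr_le _ th _ pos.
  by exists m; apply: small; rewrite mulrC -ler_pdivlMr.
case: (ex_minnP ex) => m am mmin; exists m; first by split.
case: m am mmin => [|m] am mmin; first by rewrite expr0 ge_min lexx.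
rewrite ge_min; apply/orP; right.
have /negP : ~ (`|L| + e) * theta ^+ m <= 1 - beta.
  by move=> /small /mmin; rewrite ltnn.
by rewrite -ltNge ler_pdivrMr // exprS -mulrA ler_pM2l // mulrC => /ltW.
Qed.

(** * Approximate projections and the minimal-norm solution *)

(** Strong convexity at [y] involves the gradient at [y], the projection inequality the one at [u].
    Exchanging them costs the factor [|L| + e], and the displacement [u - y] in the projection
    inequality adds 1. *)
Lemma approx_projection_le (R : realType) (H : completeNormedModType R)
    (ip : {dot H for idfun}) (ip_norm : forall x : H, ip x x = `|x| ^+ 2)
    (D : set H) (D_convex : convex_set D) (D_closed : closed D)
    (f : H -> R) (f_convex : convex_function D f)
    (f' : H -> H) (f_gradient : is_gradient_on ip D f f')
    (L : R) (f'_lipschitz : L.-lipschitz_D f')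
    (e : R) (e_gt0 : 0 < e) (u z : H) (y := metric_proj D
      (u - regularized_gradient f' e u)) :
  D u -> D z ->
  regularized f e y + 2^-1 * e * `|z - y| ^+ 2 <=
    regularized f e z + (1 + `|L| + e) * `|u - y| * `|z - y|.
Proof.
move=> Du Dz; have D0 : D !=set0 by exists u.
have := metric_proj_dot_le0 ip_norm D_convex D_closed
  (u - regularized_gradient f' e u) Dz.
have [+ _] := metric_projP ip_norm D0 D_convex D_closed
  (u - regularized_gradient f' e u).
rewrite -/y => Dy.
have := regularized_ge ip_norm D_convex f_convex f_gradient e Dy Dz.
have := lipschitz_dot_le ip_norm f'_lipschitz (z - y) Dy Du.
have := dot_le_norm ip_norm (y - u) (z - y).
have := dot_le_norm ip_norm (e *: (u - y)) (z - y).
rewrite normrZ (gtr0_norm e_gt0) dotZl /regularized_gradient (distrC y u).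
rewrite !(linearDl, linearBl, linearNl) /= !dotZl.
clear; clearbody y; move: (ip _ _) (ip _ _) (ip _ _) (ip _ _) => a b c d; lra.
Qed.

(** The affine minorant of [f] at a limit point [z] bounds [f z] by [b] plus an error that vanishes
    as points of the set approach [z]. *)
Lemma closed_sublevel (R : realType) (H : completeNormedModType R)
    (ip : {dot H for idfun}) (ip_norm : forall x : H, ip x x = `|x| ^+ 2)
    (D : set H) (D_convex : convex_set D) (D_closed : closed D)
    (f : H -> R) (f_convex : convex_function D f)
    (f' : H -> H) (f_gradient : is_gradient_on ip D f f') (b : R) :
  closed [set z | D z /\ f z <= b].
Proof.
move=> z zcl; have Dz : D z.
  by apply: D_closed; apply: closureS zcl => v [].
split=> //; rewrite -subr_le0.
apply: (@le0_of_le_mulr _ _ `|f' z|) => e /andP[e0 _].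
have [v [[Dv fv] /=]] := zcl _ (nbhsx_ballx z e e0).
rewrite -ball_normE /= distrC => vz.
have := gradient_le D_convex f_convex f_gradient Dz Dv.
have := dot_le_norm ip_norm (- f' z) (v - z).
rewrite normrN linearNl /=.
have : `|f' z| * `|v - z| <= `|f' z| * e by rewrite ler_wpM2l // ltW.
by move: (ip _ _) => a; lra.
Qed.

(** The norm bound covers almost-minimizers because it will be applied to a midpoint that need not
    minimize [f]. *)
Lemma min_norm_solution (R : realType) (H : completeNormedModType R)
    (ip : {dot H for idfun}) (ip_norm : forall x : H, ip x x = `|x| ^+ 2)
    (D : set H) (D_convex : convex_set D) (D_closed : closed D)
    (f : H -> R) (f_convex : convex_function D f)
    (f' : H -> H) (f_gradient : is_gradient_on ip D f f')
    (solvable : minimizers D f !=set0) :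
  exists2 q, minimizers D f q &
    forall e : R, 0 < e -> exists2 a, 0 < a &
      forall z, D z -> f z <= f q + a -> `|q| ^+ 2 - e <= `|z| ^+ 2.
Proof.
have [p [Dp pmin]] := solvable.
have [n|n|n u v [Du fu] [Dv fv]|m n mn z [Dz fz]|q Cq qmin] :=
  @nested_min_norm _ _ _ ip_norm
    (fun n => [set z | D z /\ f z <= f p + n.+1%:R^-1]) p.
- by split=> //; rewrite lerDl invr_ge0.
- exact: (closed_sublevel ip_norm D_convex D_closed f_convex f_gradient).
- have half : 0 <= (2^-1 : R) <= 1 by apply/andP; split; lra.
  split; first exact: convex_set_segment.
  apply: le_trans (convex_function_segment f_convex Du Dv half) _.
  by move: (n.+1%:R^-1) fu fv => a; lra.
- split=> //; apply: le_trans fz _.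
  by rewrite lerD2l lef_pV2 ?posrE // ler_nat.
have [Dq _] := Cq 0%N.
have fq : f q = f p.
  apply/eqP; rewrite eq_le pmin // andbT; apply/ler_addgt0Pr => e e0.
  have [N _ /(_ N (leqnn N)) /= hN] := near_infty_natSinv_lt (PosNum e0).
  have [_ /le_trans] := Cq N; apply.
  by rewrite lerD2l ltW.
exists q; first by split=> // z Dz; rewrite fq; exact: pmin.
move=> e /qmin[n hn]; exists n.+1%:R^-1; first by rewrite invr_gt0.
by move=> z Dz; rewrite fq => fz; exact: hn.
Qed.

(** One threshold [r] controls both the regularization parameter and the ratio of tolerance to it.
    The midpoint of [q] and [y] almost minimizes [f], so its norm is nearly at least that of [q]. *)
Lemma approx_projection_near_solution (R : realType)
    (H : completeNormedModType R)
    (ip : {dot H for idfun}) (ip_norm : forall x : H, ip x x = `|x| ^+ 2)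
    (D : set H) (D_convex : convex_set D) (D_closed : closed D)
    (f : H -> R) (f_convex : convex_function D f)
    (f' : H -> H) (f_gradient : is_gradient_on ip D f f')
    (L : R) (f'_lipschitz : L.-lipschitz_D f')
    (q : H) (q_min : minimizers D f q)
    (q_norm : forall e : R, 0 < e -> exists2 a, 0 < a &
      forall z, D z -> f z <= f q + a -> `|q| ^+ 2 - e <= `|z| ^+ 2)
    (t : R) (t_gt0 : 0 < t) :
  exists2 r : R, 0 < r & forall (e : R) u, 0 < e <= r -> D u ->
    let y := metric_proj D (u - regularized_gradient f' e u) in
    `|u - y| <= r * e -> `|q - y| <= t.
Proof.
have [Dq qm] := q_min.
(* The last estimate uses this quantity six times: four for the norm bound at the midpoint, two for
   [A ^+ 2] below. *)
have e0 : 0 < t ^+ 2 / 6 by rewrite divr_gt0 ?exprn_gt0.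
have [a a0 ha] := q_norm _ e0.
have k0 : 0 < 2 + `|L| by have := normr_ge0 L; lra.
have c0 : 0 < `|q| ^+ 2 + (2 + `|L|) * (`|q| + 2).
  by rewrite ltr_wpDl ?sqr_ge0 // mulr_gt0 //; have := normr_ge0 q; lra.
(* With [A = r * (2 + |L|)], the four terms give [r <= 1], [A <= 1], [A <= t ^+ 2 / 6] and
   [r * |q| ^+ 2 + A * (|q| + 2) <= a]. *)
pose r := Num.min (Num.min 1 (1 / (2 + `|L|)))
  (Num.min (t ^+ 2 / 6 / (2 + `|L|))
           (a / (`|q| ^+ 2 + (2 + `|L|) * (`|q| + 2)))).
have r0 : 0 < r.
  by rewrite !lt_min ltr01 (divr_gt0 ltr01 k0) (divr_gt0 e0 k0) divr_gt0.
have := lexx r.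
rewrite {2}/r !le_min !ler_pdivlMr // => /andP[/andP[r1 rk] /andP[re ra]].
rewrite mulrDr [r * (_ * (_ + 2))]mulrA in ra.
clearbody r; exists r => // e u /andP[e_gt0 er] Du y uy.
have D0 : D !=set0 by exists u.
have [+ _] := metric_projP ip_norm D0 D_convex D_closed
  (u - regularized_gradient f' e u).
have := approx_projection_le ip_norm D_convex D_closed f_convex f_gradient
  f'_lipschitz e_gt0 Du Dq.
rewrite -/y /regularized => approx Dy.
have qy : f q <= f y := qm _ Dy.
have half : 0 <= (2^-1 : R) <= 1 by apply/andP; split; lra.
have fm := convex_function_segment f_convex Dq Dy half.
have := ha _ (convex_set_segment D_convex Dq Dy half).
have := sqr_norm_midpoint ip_norm q y.
move: (normr_ge0 (q - y)) (normr_ge0 q) (sqr_ge0 `|y|) approx.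
move: (q + 2^-1 *: _) fm => m fm.
have : (1 + `|L| + e) * `|u - y| <= r * (2 + `|L|) * e.
  rewrite mulrAC mulrC.
  by apply: ler_pM => //; have := normr_ge0 L; lra.
have : 0 <= r * (2 + `|L|) by rewrite mulr_ge0 ?ltW.
move: (r * (2 + _)) (_ * `|u - y|) rk re ra => A B A1 At + A0 BA.
move: `|q - y| `|q| `|y| => s Q Y Aa s0 Q0 Y0 approx mid hm.
(* From [f q <= f y] and [B <= A * e], after division by [e / 2]. *)
have As2 : Y ^+ 2 + s ^+ 2 <= Q ^+ 2 + 2 * A * s.
  rewrite -(ler_pM2l e_gt0).
  have : B * s <= A * e * s by rewrite ler_wpM2r.
  lra.
(* Otherwise [A <= 1] makes [s * (s - 2 * A)] exceed [Q ^+ 2], against [As2]. *)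
have s_le : s <= Q + 2.
  rewrite leNgt; apply/negP => sB.
  have : Q * Q < s * (s - 2 * A).
    apply: (@le_lt_trans _ _ (Q * s)); first by rewrite ler_wpM2l //; lra.
    by rewrite mulrC ltr_pM2l; lra.
  by rewrite expr2 in Y0; rewrite !expr2 in As2; lra.
(* The choice of [r] bounds [f y - f q] by [a], and convexity passes this to the midpoint [m]. *)
have fa : f m <= f q + a.
  have Q2 : e * Q ^+ 2 <= r * Q ^+ 2 by rewrite ler_wpM2r ?sqr_ge0.
  have es : e * (A * s) <= 1 * (A * (Q + 2)).
    by rewrite ler_pM // ?ler_wpM2l ?mulr_ge0 //; lra.
  have Bs : B * s <= A * e * s by rewrite ler_wpM2r.
  have : 0 <= e * Y ^+ 2 by rewrite mulr_ge0 // ltW.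
  have : 0 <= e * s ^+ 2 by rewrite mulr_ge0 ?sqr_ge0 // ltW.
  have : 0 <= r * Q ^+ 2 by rewrite mulr_ge0 ?sqr_ge0 // ltW.
  lra.
have A2 : A ^+ 2 <= t ^+ 2 / 6.
  by apply: (@le_trans _ _ A); [rewrite expr2 ler_piMl | lra].
have sA : 0 <= (s - A) ^+ 2 by exact: sqr_ge0.
rewrite -(@ler_pXn2r _ 2%N) ?nnegrE ?(ltW t_gt0) //.
by have := hm fa; rewrite mid; lra.
Qed.

(** * Termination of a stage *)

Lemma gprm_stage_terminates (R : realType) (H : completeNormedModType R)
    (ip : {dot H for idfun}) (ip_norm : forall x : H, ip x x = `|x| ^+ 2)
    (D : set H) (D_convex : convex_set D) (D_closed : closed D)
    (f : H -> R) (f_convex : convex_function D f)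
    (f' : H -> H) (f_gradient : is_gradient_on ip D f f')
    (L : R) (f'_lipschitz : L.-lipschitz_D f')
    (solvable : minimizers D f !=set0)
    (beta theta : R) (beta01 : 0 < beta < 1) (theta01 : 0 < theta < 1)
    (delta eps : nat -> R)
    (delta_gt0 : forall l, 0 < delta l) (eps_gt0 : forall l, 0 < eps l)
    (w : nat -> H) (x : nat -> nat -> H)
    (run : gprm_run D f f' beta theta delta eps w x) (l : nat) :
  D (w l) ->
  exists K, [/\ gprm_first_stop D f' delta eps x l.+1 K,
    D (x l.+1 K) &
    forall k, (k < K)%N ->
      exists m, gprm_exponent D f f' beta theta eps x l.+1 k m].
Proof.
move=> Dw; have D0 : D !=set0 by exists (w l).
have [c c0 hc] := armijo_exponent_lower_bound ip_norm D_convex D_closed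
  f_convex f_gradient f'_lipschitz (eps_gt0 l.+1) beta01 theta01.
have /andP[beta0 _] := beta01; have /andP[theta0 theta1] := theta01.
set stop := gprm_stop D f' delta eps x l.+1.
set phi := regularized f (eps l.+1).
(* Before stopping, the step is at least [c] and the direction is longer than [delta l.+1]. *)
pose gain := beta * c * delta l.+1 ^+ 2.
have gain0 : 0 < gain by rewrite !mulr_gt0 ?exprn_gt0.
have descent k : (forall j, (j < k)%N -> ~ stop j) ->
    D (x l.+1 k) /\ phi (x l.+1 k) <= phi (w l) - k%:R * gain.
  elim: k => [_|k IHk nstop].
    by rewrite (gprm_stage run) mul0r subr0.
  have [Dk phik] := IHk (fun j jk => nstop j (ltnW jk)).
  have [m am cm] := hc _ Dk.
  have nk : forall j, (j <= k)%N -> ~ stop j by move=> j jk; apply: nstop.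
  rewrite (gprm_next run nk am).
  have [Dy _] := metric_projP ip_norm D0 D_convex D_closed
    (x l.+1 k - regularized_gradient f' (eps l.+1) (x l.+1 k)).
  have t1 : theta ^+ m <= 1 by rewrite exprn_ile1 // ltW.
  have t0 : 0 <= theta ^+ m by rewrite exprn_ge0 // ltW.
  split; first by apply: convex_set_segment => //; rewrite t0.
  apply: le_trans am.1 _.
  have /negP := nk k (leqnn k); rewrite /stop /gprm_stop -ltNge distrC => dk.
  have : gain <= beta * theta ^+ m *
      `|gprm_y D f' eps x l.+1 k - x l.+1 k| ^+ 2.
    rewrite /gain -!mulrA ler_pM2l //; apply: ler_pM => //; first exact: ltW.
      exact: sqr_ge0.
    by rewrite ler_pXn2r ?nnegrE ?(ltW dk) // ltW.
  rewrite -/phi -natr1 mulrDl mul1r; move: phik.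
  by move: (k%:R * gain) (_ * `|_| ^+ 2) => a b; rewrite /gprm_y; lra.
have [p [Dp pmin]] := solvable.
(* Otherwise the linear decrease would push [phi] below [f p], a lower bound since the added
   quadratic term is nonnegative. *)
have ex : exists k, `|x l.+1 k - gprm_y D f' eps x l.+1 k| <= delta l.+1.
  apply: contrapT => never.
  have nstop k : ~ stop k by move=> sk; apply: never; exists k.
  have bound k : k%:R * gain <= phi (w l) - f p.
    have [Dk phik] := descent k (fun j _ => nstop j).
    have : f p <= phi (x l.+1 k).
      apply: le_trans (pmin _ Dk) _; rewrite lerDl.
      by rewrite !mulr_ge0 ?invr_ge0 ?sqr_ge0 // ltW.
    lra.
  have B0 : 0 <= phi (w l) - f p by have := bound 0%N; rewrite mul0r.
  have := archi_boundP (divr_ge0 B0 (ltW gain0)).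
  by rewrite ltr_pdivrMr // ltNge bound.
case: (ex_minnP ex) => K stopK Kmin; exists K.
have nstop j : (j < K)%N -> ~ stop j by move=> jK /Kmin; rewrite leqNgt jK.
split; [by split|exact: (descent K nstop).1|move=> k kK].
have [Dk _] := descent k (fun j jk => nstop j (ltn_trans jk kK)).
by have [m am _] := hc _ Dk; exists m.
Qed.

(** * Uniqueness and strong convergence *)

(** The midpoint of two least-norm points has no smaller norm, so the parallelogram law makes their
    distance zero. *)
Lemma min_norm_unique (R : realType) (H : completeNormedModType R)
    (ip : {dot H for idfun}) (ip_norm : forall x : H, ip x x = `|x| ^+ 2)
    (C : set H) (q : H) :
  C q -> (forall u v, C u -> C v -> C (u + 2^-1 *: (v - u))) ->
  (forall z, C z -> `|q| ^+ 2 <= `|z| ^+ 2) ->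
  minimizers C (fun z => 2^-1 * `|z| ^+ 2) = [set q].
Proof.
move=> Cq Cmid qmin; apply/seteqP; split=> [z [Cz zmin]|z ->] /=; last first.
  by split=> // u Cu; rewrite ler_pM2l ?qmin ?invr_gt0.
have := zmin _ Cq; have := qmin _ (Cmid _ _ Cz Cq).
have := sqr_norm_midpoint ip_norm z q => h1 h2 h3.
have : `|z - q| ^+ 2 <= 0 by lra.
by rewrite exprn_even_le0 //= normr_eq0 subr_eq0 => /eqP.
Qed.

Theorem theorem1 (R : realType) (H : completeNormedModType R)
    (ip : {dot H for idfun}) (ip_norm : forall x : H, ip x x = `|x| ^+ 2)
    (D : set H) (D_nonempty : D !=set0) (D_convex : convex_set D)
    (D_closed : closed D)
    (f : H -> R)
    (f_lsc : lower_semicontinuous (fun x : subspace D => (f x)%:E))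
    (f_convex : convex_function D f)
    (f' : H -> H) (f_gradient : is_gradient_on ip D f f')
    (L : R) (f'_lipschitz : L.-lipschitz_D f')
    (solvable : minimizers D f !=set0)
    (beta theta : R) (beta01 : 0 < beta < 1) (theta01 : 0 < theta < 1)
    (delta eps : nat -> R)
    (delta_gt0 : forall l, 0 < delta l) (delta_decr : decreasing_seq delta)
    (delta_cvg : delta @ \oo --> (0 : R))
    (eps_gt0 : forall l, 0 < eps l) (eps_decr : decreasing_seq eps)
    (eps_cvg : eps @ \oo --> (0 : R))
    (ratio_cvg : (fun l => delta l / eps l) @ \oo --> (0 : R))
    (w : nat -> H) (x : nat -> nat -> H)
    (run : gprm_run D f f' beta theta delta eps w x) :
  (forall l, exists2 K,
     gprm_first_stop D f' delta eps x l.+1 K &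
     forall k, (k < K)%N ->
       exists m, gprm_exponent D f f' beta theta eps x l.+1 k m) /\
  (exists2 xn,
     minimizers (minimizers D f) (fun z => 2^-1 * `|z| ^+ 2) = [set xn] &
     w @ \oo --> xn).
Proof.
have stage := gprm_stage_terminates ip_norm D_convex D_closed
  f_convex f_gradient f'_lipschitz solvable beta01 theta01 delta_gt0 eps_gt0 run.
have projD v := (metric_projP ip_norm D_nonempty D_convex D_closed v).1.
(* Termination of a stage requires its start in [D]; either choice of output keeps the next start
   there. *)
have Dw l : D (w l).
  elim: l => [|l /stage[K [stopK DxK _]]]; first exact: gprm_start run.
  by have [[->|->] _] := gprm_output run stopK; last exact: projD.
split=> [l|].
  by have [K [stopK _ expK]] := stage l (Dw l); exists K.
have [q qmin q_norm] :=
  min_norm_solution ip_norm D_convex D_closed f_convex f_gradient solvable.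
have [Dq fq] := qmin; exists q.
  apply: (min_norm_unique ip_norm) => // [u v [Du fu] [Dv fv]|z [Dz fz]].
    have half : 0 <= (2^-1 : R) <= 1 by apply/andP; split; lra.
    split=> [|z Dz]; first exact: convex_set_segment.
    apply: le_trans (convex_function_segment f_convex Du Dv half) _.
    by have := fu _ Dz; have := fv _ Dz; lra.
  apply/ler_addgt0Pr => e e0; have [a a0 ha] := q_norm e e0.
  rewrite -lerBlDr; apply: ha => //.
  by apply: le_trans (fz _ Dq) _; rewrite lerDl ltW.
apply/cvgrPdist_le => t t0; have t20 : 0 < t / 2 by rewrite divr_gt0.
have [r r0 near_q] := approx_projection_near_solution ip_norm D_convex D_closed
  f_convex f_gradient f'_lipschitz qmin q_norm t20.
have [N1 _ hN1] := cvgr_le _ eps_cvg _ r0.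
have [N2 _ hN2] := cvgr_le _ ratio_cvg _ r0.
have [N3 _ hN3] := cvgr_le _ delta_cvg _ t20.
(* The successor excludes [w 0], which no stage produces. *)
exists (maxn N1 (maxn N2 N3)).+1 => // -[//|l] /=; rewrite ltnS !geq_max.
move=> /and3P[/leqW/hN1 /= el /leqW/hN2 /= rl /leqW/hN3 /= dl].
have [K [stopK DxK _]] := stage l (Dw l).
have [sK _] := stopK; rewrite /gprm_stop in sK.
have := near_q (eps l.+1) (x l.+1 K); rewrite eps_gt0 el => /(_ isT DxK) /=.
rewrite -/(gprm_y D f' eps x l.+1 K) -ler_pdivrMr //.
have sr : `|x l.+1 K - gprm_y D f' eps x l.+1 K| / eps l.+1 <= r.
  by apply: le_trans rl; rewrite ler_pM2r ?invr_gt0.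
move=> /(_ sr) qy.
(* If the iterate is chosen instead of its projection, the stopping tolerance adds the second
   [t / 2]. *)
have [[->|->] _] := gprm_output run stopK; last by lra.
have := ler_distD (gprm_y D f' eps x l.+1 K) q (x l.+1 K).
by rewrite [`|gprm_y _ _ _ _ _ _ - _|]distrC; lra.
Qed.
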